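(* Let $G$ be a finite group. If $A$ and $B$ are quasinormal subgroups of $G$, then $(A\cap B)^{G}/(A\cap B)_{G}\leq Z_{\infty}(G/(A\cap B)_{G})$.
   Context: For $X\le G$: $X^{G}$ is the normal closure of $X$ in $G$ and $X_{G}=\bigcap_{x\in G}X^{x}$ is the core of $X$ in $G$. $Z_{\infty}(G)$ is the hypercentre of $G$ (the last term of the upper central series). A subgroup $A$ of $G$ is quasinormal in $G$ if $AH=HA$ for all subgroups $H$ of $G$. *)

(* Defs.v *)
From mathcomp Require Import all_boot all_fingroup all_solvable.

Set Implicit Arguments.
Unset Strict Implicit.
Unset Printing Implicit Defensive.

Local Open Scope group_scope.

(* [A * H] is the product of the underlying sets, not the generated subgroup. *)
Definition quasinormal (gT : finGroupType) (A G : {group gT}) : Prop :=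
  A \subset G /\ forall H : {group gT}, H \subset G -> A * H = H * A.

Definition normal_closure (gT : finGroupType) (X G : {set gT}) : {set gT} :=
  <<class_support X G>>.

(* In a finite group the upper central series is constant from index [#|G|]
   on, so its last term is the term of that index: see [ucn_hypercentre]. *)
Definition hypercentre (gT : finGroupType) (G : {set gT}) : {set gT} :=
  'Z_#|G|(G).

Lemma ucn_hypercentre (gT : finGroupType) (G : {group gT}) (n : nat) :
  #|G| <= n -> 'Z_n(G) = hypercentre G.
Proof.
have stab m k : 'Z_m.+1(G) = 'Z_m(G) -> 'Z_(m + k)(G) = 'Z_m(G).
  move=> eqm; elim: k => [|k IHk]; first by rewrite addn0.
  by rewrite addnS ucnSn IHk -ucnSn.
have [m le_mG eqm] : exists2 m, m <= #|G| & 'Z_m.+1(G) = 'Z_m(G).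
  suff grow k : (exists2 m, m <= k & 'Z_m.+1(G) = 'Z_m(G)) \/ k < #|'Z_k(G)|.
    by case: (grow #|G|) => //; rewrite ltnNge subset_leq_card ?ucn_sub.
  elim: k => [|k [[m le_mk eqm]|ltk]]; first by right; rewrite cardG_gt0.
    by left; exists m; first exact: leqW.
  case: (eqVneq 'Z_k.+1(G) 'Z_k(G)) => [eqk|neqk]; first by left; exists k.
  right; apply: leq_ltn_trans ltk (proper_card _).
  by rewrite properEneq eq_sym neqk ucn_subS.
move=> leGn; rewrite /hypercentre.
rewrite -(subnKC le_mG) -(subnKC (leq_trans le_mG leGn)).
by rewrite !stab.
Qed.

(* Main.v *)
Require Import Defs.
From mathcomp Require Import all_boot all_fingroup all_solvable.

Set Implicit Arguments.
Unset Strict Implicit.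
Unset Printing Implicit Defensive.

Local Open Scope group_scope.

(** Everything rests on the theorem of Maier and Schmid: if [A] is quasinormal
    in [G] and [A] has trivial core, then [A] lies in the hypercentre of [G]
    ([quasinormal_core_free_sub_hypercentre]).  Granting it, apply it in
    [G / A_G] and in [G / B_G].  Since [G / (A_G :&: B_G)] embeds into the
    product of these two quotients and [(A :&: B)_G = A_G :&: B_G], an element
    of [A :&: B] is hypercentral modulo [(A :&: B)_G]
    ([mem_ucn_quotientI]); the hypercentre being normal, it contains the
    normal closure as well.

    To prove the theorem of Maier and Schmid, note that a quasinormal [A] is
    subnormal ([quasinormal_subnormal]), so that [A] is subnormal in
    [A <[x]>] for each [x].  Comparing indices, a [pi]-element [x] of [G]
    normalises [O^pi(A)] and a [pi']-element normalises [O_pi(A)].  This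
    gives the theorem of Ito and Szep: a core-free quasinormal [A] is nilpotent
    ([quasinormal_core_free_nilpotent]).

    It remains to treat [M = O_p(A)].  All [p']-elements normalise [M], and [M]
    permutes with all cyclic [p]-subgroups.  Let [Y] be a Sylow [q]-subgroup of
    [G] with [q <> p], and let [g] be a [p]-element normalising [Y].  The group
    [T = M^<g>] is a [p]-group normalised by [Y] and [g], and [T = C M] with
    [C <= <g>].  Then [[C, Y] <= T :&: Y = 1], so [[T, Y] <= M]; the left side
    is [g]-invariant, so [[M, Y] <= M^(g^-1)] ([conj_commutator_sub]).  By the
    Frattini argument the conjugates of [M] under such [g] are all the
    conjugates, so [[M, Y]] lies in the core of [M], that is, [[M, Y] = 1].
    Hence the normal closure of [M] is a [p]-group centralised by all
    Sylow [q]-subgroups with [q <> p], and a Sylow [p]-subgroup acts on it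
    nilpotently; so it is hypercentral ([cent_Sylow_sub_hypercentre]). *)

(** * Quasinormal subgroups *)

Lemma quasinormal_sub (gT : finGroupType) (A G : {group gT}) :
  quasinormal A G -> A \subset G.
Proof. by case. Qed.

Lemma quasinormalS (gT : finGroupType) (A H G : {group gT}) :
  A \subset H -> H \subset G -> quasinormal A G -> quasinormal A H.
Proof.
by move=> sAH sHG [_ qA]; split=> // K sKH; apply: qA (subset_trans sKH sHG).
Qed.

Lemma quasinormal_quotient (gT : finGroupType) (A N G : {group gT}) :
  N <| G -> quasinormal A G -> quasinormal (A / N)%G (G / N)%G.
Proof.
case/andP=> sNG nNG [sAG qA]; split=> [|H sHGN]; first exact: quotientS.
have [K defH sKG] : exists2 K : {group gT}, H :=: K / N & K \subset G.
  exists (coset N @*^-1 H)%G; first by rewrite /= cosetpreK.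
  by rewrite sub_cosetpre_quo ?(normalS _ _ (normalG _)) //; apply/andP.
rewrite defH /= -!quotientMl ?(subset_trans _ nNG) //.
by rewrite qA.
Qed.

Lemma quasinormal_conj (gT : finGroupType) (A G : {group gT}) x :
  x \in G -> quasinormal A G -> quasinormal (A :^ x)%G G.
Proof.
move=> Gx [sAG qA]; split=> [|H sHG].
  by rewrite -(conjGid Gx) conjSg.
apply: (@conjsg_inj _ x^-1); rewrite !conjsMg /= conjsgK.
by rewrite (qA (H :^ x^-1)%G) // -(conjGid (groupVr Gx)) conjSg.
Qed.

Lemma quasinormalY (gT : finGroupType) (A B G : {group gT}) :
  quasinormal A G -> quasinormal B G -> quasinormal (A <*> B)%G G.
Proof.
move=> [sAG qA] [sBG qB]; split=> [|H sHG]; first by rewrite join_subG sAG.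
rewrite /= comm_joingE; last exact: qA.
by rewrite -mulgA qB // !mulgA qA.
Qed.

(** A proper subgroup and one of its conjugates never have the whole group as
    their product. *)
Lemma mul_conj_eq (gT : finGroupType) (A G : {group gT}) x :
  A \subset G -> x \in G -> A * (A :^ x) = G -> A :=: G.
Proof.
move=> sAG Gx defG; have: x \in A * A :^ x by rewrite defG.
case/mulsgP=> a b Aa; rewrite mem_conjg => Abx def_x.
have Ax : x \in A.
  have e1 : b * x^-1 * a = 1 by rewrite def_x invMg mulKVg mulVg.
  have -> : x = (b ^ x^-1) * a.
    by rewrite conjgE invgK -!mulgA (mulgA b) e1 mulg1.
  by rewrite groupM.
by rewrite -defG conjGid // mulGid.
Qed.

(** Ore: if [A] is proper, then a maximal element [M] among the proper
    quasinormal subgroups containing [A] is normal, because each [M M^x] is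
    quasinormal and proper; and [A] is quasinormal in [M]. *)
Lemma quasinormal_subnormal (gT : finGroupType) (A G : {group gT}) :
  quasinormal A G -> A <|<| G.
Proof.
have [n] := ubnP #|G|; elim: n G => // n IHn G; rewrite ltnS => leGn qA.
have sAG := quasinormal_sub qA.
have [-> | neAG] := eqVneq A G; first exact: subnormal_refl.
have exM : exists M : {group gT}, [&& M \proper G, A \subset M &
    [forall H : {group gT}, (H \subset G) ==> (M * H == H * M)]].
  exists A; rewrite properEneq neAG sAG subxx /=.
  by apply/forall_inP=> H sHG; apply/eqP/(proj2 qA).
have [M] := ex_maxgroup exM.
case/maxgroupP=> /and3P[ltMG sAM /forall_inP permM] maxM.
have qM : quasinormal M G.
  by split=> [|H /permM/eqP//]; apply: proper_sub.
have nMG : M <| G.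
  rewrite /normal proper_sub //; apply/subsetP=> x Gx.
  have qMx := quasinormal_conj Gx qM.
  have [sMG _] := qM; have [sMxG _] := qMx.
  have qMM := quasinormalY qM qMx.
  have defMM : M <*> (M :^ x) = M * (M :^ x).
    by rewrite comm_joingE //; apply: (proj2 qM _ sMxG).
  have ltMM : M <*> (M :^ x) \proper G.
    rewrite properEneq (quasinormal_sub qMM) andbT defMM; apply/eqP=> defG.
    by rewrite (mul_conj_eq sMG Gx defG) properxx in ltMG.
  have defM : M <*> (M :^ x) = M.
    apply: (maxM (M <*> M :^ x)%G); last exact: joing_subl.
    rewrite ltMM (subset_trans sAM) ?joing_subl //=.
    by apply/forall_inP=> H sHG; apply/eqP/(proj2 qMM).
  by rewrite inE -{2}defM joing_subr.
apply: subnormal_trans (normal_subnormal nMG).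
apply: IHn; first exact: leq_trans (proper_card ltMG) leGn.
exact: quasinormalS sAM (proper_sub ltMG) qA.
Qed.

Lemma gcore_quotient_trivg (gT : finGroupType) (A G : {group gT}) :
  A \subset G -> gcore (A / gcore A G) (G / gcore A G) = 1.
Proof.
move=> sAG; set N := gcore A G.
have nsNG : N <| G := gcore_normal sAG.
have nsNA : N <| A by apply: normalS nsNG => //; apply: gcore_sub.
apply/eqP; rewrite eqEsubset sub1G andbT -[1](trivg_quotient N%G).
have nsK : gcore (A / N) (G / N) <| G / N by rewrite gcore_normal ?quotientS.
have [K defK sNK nsKG] := inv_quotientN nsNG nsK.
move: (gcore_sub (A / N) (G / N)); rewrite /= in defK *; rewrite defK.
have nNK : K \subset 'N(N) := subset_trans (normal_sub nsKG) (gcore_norm A G).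
rewrite (quotientSGK nNK) ?gcore_sub //.
by move=> sKA; rewrite quotientS // gcore_max ?normal_norm.
Qed.

(** * Residuals of subnormal subgroups *)

(** [O^pi(A)], the smallest normal subgroup of [A] with a quotient that is a
    [pi]-group, given as the subgroup generated by the [pi']-elements of [A].
    In particular [pi_residual q^' A] is generated by the [q]-elements. *)
Definition pi_residual (gT : finGroupType) (pi : nat_pred) (A : {set gT}) :=
  <<[set x in A | pi^'.-elt x]>>.

Canonical pi_residual_group (gT : finGroupType) pi (A : {set gT}) :=
  Eval hnf in [group of pi_residual pi A].

Lemma mem_pi_residual (gT : finGroupType) (pi : nat_pred) (A : {set gT}) x :
  x \in A -> pi^'.-elt x -> x \in pi_residual pi A.
Proof. by move=> Ax pi'x; rewrite mem_gen // inE Ax. Qed.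

Lemma pi_residual_sub (gT : finGroupType) (pi : nat_pred) (A : {group gT}) :
  pi_residual pi A \subset A.
Proof. by rewrite gen_subG; apply/subsetP=> x; rewrite inE => /andP[]. Qed.

Lemma pi_residualS (gT : finGroupType) (pi : nat_pred) (A B : {set gT}) :
  A \subset B -> pi_residual pi A \subset pi_residual pi B.
Proof.
move/subsetP=> sAB; rewrite genS //.
by apply/subsetP=> x; rewrite !inE => /andP[/sAB->].
Qed.

Lemma norm_pi_residual (gT : finGroupType) (pi : nat_pred) (A : {set gT}) :
  'N(A) \subset 'N(pi_residual pi A).
Proof.
apply: subset_trans (norm_gen _); apply/subsetP=> x nAx.
rewrite inE; apply/subsetP=> _ /imsetP[y + ->]; rewrite !inE => /andP[Ay].
by rewrite memJ_norm // p_eltJ Ay.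
Qed.

Lemma subnormal_pi'_elt (gT : finGroupType) (pi : nat_pred)
    (A G : {group gT}) x :
  A <|<| G -> pi.-nat #|G : A| -> x \in G -> pi^'.-elt x -> x \in A.
Proof.
have [n] := ubnP #|G|; elim: n G => // n IHn G; rewrite ltnS => leGn snA.
case: (subnormalEr snA) => [-> // | [K [snAK nsKG ltKG]]] piGA Gx pi'x.
have sAK := subnormal_sub snAK; have [sKG nKG] := andP nsKG.
have /andP[piGK piKA] : pi.-nat #|G : K| && pi.-nat #|K : A|.
  by rewrite -(Lagrange_index sKG sAK) pnatM in piGA.
apply: (IHn K) => //; first exact: leq_trans (proper_card ltKG) leGn.
rewrite coset_idr ?(subsetP nKG) //; apply/eqP; rewrite -order_eq1.
have pi_x : pi.-elt (coset K x).
  by apply: mem_p_elt (mem_quotient K Gx); rewrite /pgroup card_quotient.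
apply/eqP; apply: pnat_1 pi_x _.
by rewrite [_.-nat _]morph_p_elt ?(subsetP nKG).
Qed.

Lemma pnat_index_join_cycle (gT : finGroupType) (pi : nat_pred)
    (A G : {group gT}) x :
  quasinormal A G -> x \in G -> pi.-elt x -> pi.-nat #|A <*> <[x]> : A|.
Proof.
move=> [_ qA] Gx pi_x; have sxG : <[x]> \subset G by rewrite cycle_subG.
have cAx : commute A <[x]> := qA <[x]>%G sxG.
by rewrite (comm_joingE cAx) indexMg -indexgI (pnat_dvd (dvdn_indexg _ _)).
Qed.

Lemma quasinormal_subnormal_join (gT : finGroupType) (A G : {group gT}) x :
  quasinormal A G -> x \in G -> A <|<| A <*> <[x]>.
Proof.
move=> qA Gx; apply: quasinormal_subnormal.
apply: (quasinormalS _ _ qA); first exact: joing_subl.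
by rewrite join_subG (quasinormal_sub qA) cycle_subG.
Qed.

Lemma subnormal_pcore_sub (gT : finGroupType) (pi : nat_pred)
    (M G : {group gT}) :
  M <|<| G -> pi.-group M -> M \subset 'O_pi(G).
Proof.
move=> snMG piM; have [n] := ubnP #|G|.
elim: n G snMG => // n IHn G snMG; rewrite ltnS => leGn.
case: (subnormalEr snMG) => [<- | [K [snMK nsKG ltKG]]].
  by rewrite pcore_max.
apply: subset_trans (IHn K snMK (leq_trans (proper_card ltKG) leGn)) _.
by rewrite pcore_max ?pcore_pgroup // gFnormal_trans.
Qed.

(** The index of [A] in [H = A <[x]>] is a [pi]-number, so [A] contains all
    [pi']-elements of [H] and [O^pi(A) = O^pi(H)]. *)
Lemma pi_elt_norm_residual (gT : finGroupType) (pi : nat_pred)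
    (A G : {group gT}) x :
  quasinormal A G -> x \in G -> pi.-elt x -> x \in 'N(pi_residual pi A).
Proof.
move=> qA Gx pi_x; pose H := (A <*> <[x]>)%G.
have sAH : A \subset H := joing_subl _ _.
have Hx : x \in H by rewrite mem_gen // inE cycle_id orbT.
suff -> : pi_residual pi A = pi_residual pi H.
  by apply: (subsetP (norm_pi_residual _ _)); apply: (subsetP (normG H)).
apply/eqP; rewrite eqEsubset pi_residualS //= gen_subG.
apply/subsetP=> y; rewrite inE => /andP[Hy pi'y].
rewrite mem_pi_residual //; apply: subnormal_pi'_elt Hy pi'y.
  exact: quasinormal_subnormal_join qA Gx.
exact: pnat_index_join_cycle qA Gx pi_x.
Qed.

(** The index of [A] in [H = A <[x]>] is a [pi']-number, so [A] contains
    [O_pi(H)] and [O_pi(A) = O_pi(H)]. *)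
Lemma pi'_elt_norm_pcore (gT : finGroupType) (pi : nat_pred)
    (A G : {group gT}) x :
  quasinormal A G -> x \in G -> pi^'.-elt x -> x \in 'N('O_pi(A)).
Proof.
move=> qA Gx pi'x; pose H := (A <*> <[x]>)%G.
have snAH : A <|<| H := quasinormal_subnormal_join qA Gx.
have sAH : A \subset H := joing_subl _ _.
have Hx : x \in H by rewrite mem_gen // inE cycle_id orbT.
suff -> : 'O_pi(A) = 'O_pi(H) by apply: (subsetP (gFnorm _ _)).
have sOA : 'O_pi(H) \subset A.
  apply/subsetP=> y Oy; apply: (@subnormal_pi'_elt _ pi^' _ _ _ snAH).
  - exact: pnat_index_join_cycle qA Gx pi'x.
  - exact: (subsetP (pcore_sub pi H)).
  by rewrite p_eltNK (mem_p_elt (pcore_pgroup pi H)).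
apply/eqP; rewrite eqEsubset subnormal_pcore_sub ?pcore_pgroup //=; last first.
  exact: subnormal_trans (normal_subnormal (pcore_normal _ _)) snAH.
by rewrite -{1}(setIidPr sOA) pcoreS.
Qed.

(** * Core-free quasinormal subgroups are nilpotent *)

Lemma sub_gcore_conj (gT : finGroupType) (X A : {set gT}) (G : {group gT}) :
  (forall g, g \in G -> X :^ g \subset A) -> X \subset gcore A G.
Proof.
move=> sXA; apply/bigcapsP=> g Gg.
by rewrite -sub_conjgV sXA ?groupV.
Qed.

Lemma groupX_constt (gT : finGroupType) (pi : nat_pred) (G : {group gT}) g :
  g \in G ->
  [/\ g.`_pi \in G, pi.-elt g.`_pi, g.`_pi^' \in G & pi^'.-elt g.`_pi^'].
Proof. by move=> Gg; rewrite !p_elt_constt !groupX. Qed.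

(** Write [g = s t] with [s] the [q]-part and [t] the [q']-part.  Then [s]
    normalises [O_q(O^q(A))] while [t] normalises the larger group [O_q(A)]; so
    all conjugates of [O_q(O^q(A))] stay inside [A]. *)
Lemma residual_pcore_core (gT : finGroupType) (q : nat) (A G : {group gT}) :
  quasinormal A G ->
  'O_q(A) :&: pi_residual q A \subset gcore A G.
Proof.
move=> qA; pose U := pi_residual_group q A.
have sRO : 'O_q(U) \subset 'O_q(A).
  rewrite pcore_max ?pcore_pgroup // gFnormal_trans // /normal pi_residual_sub.
  exact: subset_trans (normG A) (norm_pi_residual _ _).
have sIR : 'O_q(A) :&: U \subset 'O_q(U).
  by rewrite setIC pcoreS ?pi_residual_sub.
apply: subset_trans sIR _; apply: sub_gcore_conj => g Gg.
have [Gs qs Gt q't] := groupX_constt q Gg.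
rewrite -(consttC q g) conjsgM.
have nUs : g.`_q \in 'N('O_q(U)).
  apply: (subsetP (gFnorm_trans _ (subxx _))).
  exact: pi_elt_norm_residual qA Gs qs.
rewrite (normP nUs); apply: subset_trans (pcore_sub q A).
by rewrite -(normP (pi'_elt_norm_pcore qA Gt q't)) conjSg.
Qed.

Lemma pgroup_residual_trivg (gT : finGroupType) (pi : nat_pred)
    (A : {group gT}) :
  pi_residual pi A = 1 -> pi.-group A.
Proof.
move=> O1; apply/pgroupP=> p p_pr /(Cauchy p_pr)[x Ax ox].
apply: contraT => pi'p; have: x \in pi_residual pi A.
  by rewrite mem_pi_residual // /p_elt ox pnatE.
by rewrite O1 inE -order_eq1 ox => /eqP p1; rewrite p1 in p_pr.
Qed.

(** The [q]-elements of [G] cannot all lie in [N], since [N] contains no Sylow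
    [q]-subgroup of [G]. *)
Lemma maxnormal_mul_residual (gT : finGroupType) (N G : {group gT}) (q : nat) :
  maxnormal N G G -> prime q -> q %| #|G : N| ->
  N <*> pi_residual q^' G = G.
Proof.
move=> maxN q_pr qGN; pose L := pi_residual_group q^' G.
have [/andP[ltNG nNG] maxN'] := maxgroupP maxN; have sNG := proper_sub ltNG.
have sLG : L \subset G := pi_residual_sub _ _.
apply/eqP; apply: contraLR qGN => neNL; rewrite -p'natE //.
have defN : N <*> L = N.
  apply: (maxN' (N <*> L)%G); last exact: joing_subl.
  rewrite properEneq neNL join_subG sNG sLG normsY //.
  exact: subset_trans (normG G) (norm_pi_residual _ _).
have [S sylS] := Sylow_exists q G; have [sSG qS q'GS] := and3P sylS.
have sSN : S \subset N.
  apply: (subset_trans _ (_ : L \subset N)); last by rewrite -defN joing_subr.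
  apply/subsetP=> x Sx; rewrite mem_pi_residual ?(subsetP sSG) //.
  by rewrite p_eltNK (mem_p_elt qS).
by apply: pnat_dvd q'GS; rewrite indexgS.
Qed.

Lemma norm_gcore (gT : finGroupType) (A : {set gT}) (G : {group gT}) x :
  x \in 'N(A) -> x \in 'N(G) -> x \in 'N(gcore A G).
Proof.
move=> nAx nGx; rewrite inE gcore_max //.
  by rewrite -{2}(normP nAx) conjSg gcore_sub.
by rewrite normJ -{1}(normP nGx) conjSg gcore_norm.
Qed.

(** The theorem of Ito and Szep. *)
Lemma quasinormal_core_free_nilpotent (gT : finGroupType) (A G : {group gT}) :
  quasinormal A G -> gcore A G = 1 -> nilpotent A.
Proof.
have [n] := ubnP #|G|.
elim: n => // n IHn in gT A G *; rewrite ltnS => leGn qA coreA.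
have sAG := quasinormal_sub qA.
case: (subnormalEr (quasinormal_subnormal qA)) => [defA | [K [snAK nsKG ltKG]]].
  have: A \subset gcore A G by rewrite sub_gcore // defA normG.
  by rewrite coreA => /trivgP->; apply: nilpotent1.
(* A maximal normal subgroup [N] containing [A]; induction applies to [N / B],
   where [B] is the core of [A] in [N]. *)
have [N maxN sKN] : {N : {group gT} | maxnormal N G G & K \subset N}.
  by apply: maxgroup_exists; rewrite ltKG normal_norm.
have sAN := subset_trans (subnormal_sub snAK) sKN.
have [/andP[ltNG nNG] _] := maxgroupP maxN; have sNG := proper_sub ltNG.
pose B := gcore_group A N; have sBA : B \subset A := gcore_sub A N.
have nsBN : B <| N := gcore_normal sAN.
have nsBA : B <| A := normalS sBA sAN nsBN.
have qAN := quasinormalS sAN sNG qA.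
have nilAB : nilpotent (A / B).
  apply: (IHn _ (A / B)%G (N / B)%G).
  - exact: leq_ltn_trans (leq_quotient _ _) (leq_trans (proper_card ltNG) leGn).
  - exact: quasinormal_quotient.
  - exact: gcore_quotient_trivg.
(* For a prime [q] dividing the index of [N], the [q]-elements generate a normal
   subgroup that supplements [N] and normalises [O^q(A)]; so the core of
   [O^q(A)] in [N] is normal in [G]. *)
have [q q_pr qGN] : exists2 q, prime q & q %| #|G : N|.
  exists (pdiv #|G : N|); rewrite ?pdiv_dvd ?pdiv_prime //.
  by rewrite indexg_gt1 proper_subn.
have defG := maxnormal_mul_residual maxN q_pr qGN.
pose U := pi_residual_group q A; have sUA : U \subset A := pi_residual_sub _ _.
have nUA : A \subset 'N(U) := subset_trans (normG A) (norm_pi_residual _ _).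
have coreU : gcore U N = 1.
  apply/trivgP; rewrite -coreA gcore_max //.
    exact: subset_trans (gcore_sub _ _) sUA.
  rewrite -{1}defG join_subG gcore_norm gen_subG.
  apply/subsetP=> x; rewrite inE p_eltNK => /andP[Gx q_x].
  by rewrite norm_gcore ?(subsetP nNG) // (pi_elt_norm_residual qA).
have qB : q.-group B.
  apply: pgroup_residual_trivg; apply/trivgP; rewrite -coreU gcore_max //.
    exact: pi_residualS.
  exact: subset_trans (gcore_norm A N) (norm_pi_residual _ _).
(* As [A / B] is nilpotent and [B] is a [q]-group, [O_q(A)] is a Sylow subgroup
   of [A]; it meets [O^q(A)] trivially because [A] is core-free.  Hence
   [A = O_q(A) x O^q(A)], and [O^q(A)] embeds into [A / B]. *)
have TI : 'O_q(A) :&: U = 1.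
  by apply/trivgP; rewrite -coreA residual_pcore_core.
have sylQ : q.-Sylow(A) 'O_q(A).
  have := nilpotent_pcore_Hall q nilAB; rewrite pquotient_pcore //.
  by rewrite pquotient_pHall // (normalS _ (pcore_sub _ _)) ?pcore_max.
have defA : 'O_q(A) * U = A.
  apply/eqP; rewrite eqEsubset mul_subG ?pcore_sub //=.
  apply/subsetP=> x Ax; have [Ax1 q1 Ax2 q2] := groupX_constt q Ax.
  rewrite -(consttC q x) mem_mulg ?mem_pi_residual //.
  by rewrite (mem_normal_Hall sylQ) ?pcore_normal.
rewrite -defA mulg_nil; last first.
  rewrite centsC; apply/commG1P/trivgP.
  rewrite -TI subsetI commg_subl commg_subr.
  by rewrite (subset_trans sUA) ?gFnorm // (subset_trans (pcore_sub _ _)).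
rewrite (pgroup_nil (pcore_pgroup _ _)) /=.
have TIB : B :&: U = 1.
  by apply/trivgP; rewrite -TI setSI ?pcore_max.
have nBU : U \subset 'N(B) := subset_trans sUA (normal_norm nsBA).
rewrite (isog_nil (quotient_isog nBU TIB)).
exact: nilpotentS (quotientS _ sUA) nilAB.
Qed.

(** * The theorem of Maier and Schmid *)

Lemma conj_commutator_sub (gT : finGroupType) (pi : nat_pred)
    (M Y : {group gT}) g :
  pi.-group M -> pi.-elt g -> pi^'.-group Y ->
  Y \subset 'N(M) -> g \in 'N(Y) -> commute M <[g]> ->
  [~: M, Y] :^ g \subset M.
Proof.
move=> piM pi_g pi'Y nMY nYg cMg.
have nYC : <[g]> \subset 'N(Y) by rewrite cycle_subG.
pose T := <<class_support M <[g]> >>%G.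
have sMT : M \subset T by rewrite sub_gen ?sub_class_support.
have nTC : <[g]> \subset 'N(T).
  exact: subset_trans (class_support_norm _ _) (norm_gen _).
have nTY : Y \subset 'N(T).
  apply: subset_trans (norm_gen _); apply/subsetP=> y Yy; rewrite inE.
  apply/subsetP=> _ /imsetP[_ /imset2P[m h Mm Ch ->] ->].
  rewrite -conjgM conjgCV conjgM memJ_class_support // memJ_norm //.
  by rewrite (subsetP nMY) // memJ_norm // groupV (subsetP nYC).
have defMC : M <*> <[g]> = <[g]> * M by rewrite comm_joingE.
have sTMC : T \subset <[g]> * M.
  rewrite -defMC gen_subG class_support_sub_norm ?joing_subl //.
  exact: subset_trans (joing_subr _ _) (normG _).
have defT : (T :&: <[g]>) * M = T by rewrite group_modr //; apply/setIidPl.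
have piT : pi.-group T.
  have piMC : pi.-group (M <*> <[g]>) by rewrite defMC pgroupM piM andbT.
  by apply: pgroupS piMC; rewrite /= defMC.
have cCY : [~: T :&: <[g]>, Y] = 1.
  apply/trivgP; rewrite -(coprime_TIg (pnat_coprime piT pi'Y)) commg_subI //.
    by rewrite setIS // (subset_trans _ nYC).
  by rewrite subsetI subxx.
(* For [t = c m], [c] in [<[g]>] and [m] in [M], [[t, y] = [c, y]^m [m, y]]. *)
have sTYM : [~: T, Y] \subset M.
  rewrite gen_subG; apply/subsetP=> _ /imset2P[t y Tt Yy ->].
  move: Tt; rewrite -defT => /mulsgP[c m Cc Mm ->].
  have -> : [~ c * m, y] = [~ m, y].
    rewrite commMgJ; suff -> : [~ c, y] = 1 by rewrite conj1g mul1g.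
    by apply/set1gP; rewrite -cCY mem_commg.
  by rewrite groupM ?groupV // memJ_norm ?(subsetP nMY).
apply: subset_trans sTYM.
have nTg : g \in 'N(T) by rewrite -cycle_subG.
by rewrite conjsRg (normP nYg) commSg // -(normP nTg) conjSg.
Qed.

Lemma commutator_Sylow_sub_gcore (gT : finGroupType) (p q : nat)
    (M G Y : {group gT}) :
  M \subset G -> p.-group M ->
  (forall x, x \in G -> p^'.-elt x -> x \in 'N(M)) ->
  (forall g, g \in G -> p.-elt g -> commute M <[g]>) ->
  q \in p^' -> q.-Sylow(G) Y ->
  [~: M, Y] \subset gcore M G.
Proof.
move=> sMG pM nMp' cMp p'q sylY; have [sYG qY _] := and3P sylY.
have p'Y : p^'.-group Y := pi_pgroup qY p'q.
pose K := pi_residual_group p G; have sKG : K \subset G := pi_residual_sub _ _.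
have nsKG : K <| G.
  by rewrite /normal sKG (subset_trans (normG G)) ?norm_pi_residual.
have nMK : K \subset 'N(M).
  by rewrite gen_subG; apply/subsetP=> x; rewrite inE => /andP[Gx /nMp'->].
have sYK : Y \subset K.
  apply/subsetP=> y Yy.
  by rewrite mem_pi_residual ?(subsetP sYG) ?(mem_p_elt p'Y).
have sylYK : q.-Sylow(K) Y := pHall_subl sYK sKG sylY.
(* By the Frattini argument each [g] in [G] is a product of a [p]-element of
   [N_G(Y)], a [p']-element and an element of [O^p(G)], and the last two
   normalise [M]. *)
apply: sub_gcore_conj => g.
have nKN : 'N_G(Y) \subset 'N(K).
  exact: subset_trans (subsetIl _ _) (normal_norm nsKG).
rewrite -(Frattini_arg nsKG sylYK) -(normC nKN).
case/mulsgP=> n k /setIP[Gn nYn] Kk ->; rewrite conjsgM.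
rewrite -{2}(normP (subsetP nMK k Kk)) conjSg.
have [Gn1 p_n1 Gn2 p'n2] := groupX_constt p Gn.
rewrite -(consttC p n) conjsgM -{2}(normP (nMp' _ Gn2 p'n2)) conjSg.
apply: (conj_commutator_sub pM p_n1 p'Y (subset_trans sYK nMK)).
  by rewrite groupX.
exact: cMp.
Qed.

(** The product [O_p(A) <[g]>] is a Sylow [p]-subgroup of [A <[g]>]. *)
Lemma commute_pcore (gT : finGroupType) (p : nat) (A G : {group gT}) g :
  quasinormal A G -> p.-Hall(A) 'O_p(A) -> g \in G -> p.-elt g ->
  commute 'O_p(A) <[g]>.
Proof.
move=> qA hallM Gg p_g; have [_ permA] := qA.
have sgG : <[g]> \subset G by rewrite cycle_subG.
have cAg : commute A <[g]> := permA <[g]>%G sgG.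
pose H := (A <*> <[g]>)%G.
have sgH : <[g]> \subset H := joing_subr _ _.
have [P sylP sgP] := Sylow_superset sgH (p_g : p.-group <[g]>).
have [sPH pP _] := and3P sylP.
have sMP : 'O_p(A) \subset P.
  apply: subset_trans (pcore_sub_Hall sylP).
  apply: subnormal_pcore_sub (pcore_pgroup _ _).
  apply: subnormal_trans (normal_subnormal (pcore_normal _ _)) _.
  exact: quasinormal_subnormal_join qA Gg.
have defM : P :&: A = 'O_p(A).
  apply: (sub_pHall hallM _ _ (subsetIr _ _)).
    exact: pgroupS (subsetIl _ _) pP.
  by rewrite subsetI sMP pcore_sub.
apply/comm_group_setP; suff -> : 'O_p(A)%G * <[g]> = P by apply: groupP.
by rewrite /= -defM group_modr // -comm_joingE //; apply/setIidPl.
Qed.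

Lemma mem_ucnS (gT : finGroupType) (n : nat) (G : {group gT}) x :
  reflect (x \in G /\ forall g, g \in G -> [~ x, g] \in 'Z_n(G))
          (x \in 'Z_n.+1(G)).
Proof.
rewrite ucnSnR inE; apply: (iffP andP) => -[Gx]; last first.
  move=> Zx; split=> //; rewrite gen_subG.
  by apply/subsetP=> _ /imset2P[_ g /set1P-> Gg ->]; apply: Zx.
by move=> /subsetP sZ; split=> // g Gg; rewrite sZ ?mem_commg ?set11.
Qed.

Lemma ucn_sub_hypercentre (gT : finGroupType) (n : nat) (G : {group gT}) :
  'Z_n(G) \subset hypercentre G.
Proof.
rewrite -(@ucn_hypercentre _ G (n + #|G|)) ?leq_addl //.
by rewrite ucn_sub_geq ?leq_addr.
Qed.

(** As [G = 'C_G(N) S] for a Sylow [p]-subgroup [S], the elements of [N] have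
    the same commutators with [G] as with the nilpotent group [S]. *)
Lemma cent_Sylow_sub_hypercentre (gT : finGroupType) (p : nat)
    (N G : {group gT}) :
  N <| G -> p.-group N ->
  (forall (q : nat) (Y : {group gT}),
     q \in p^' -> q.-Sylow(G) Y -> Y \subset 'C(N)) ->
  N \subset hypercentre G.
Proof.
move=> nsNG pN cNY; have [sNG nNG] := andP nsNG.
have [S sylS] := Sylow_exists p G; have [sSG pS p'GS] := and3P sylS.
have pGC : p.-nat #|G : 'C_G(N)|.
  apply/pnatP=> [|q q_pr]; first exact: indexg_gt0.
  apply: contraLR => p'q; have [Y sylY] := Sylow_exists q G.
  have [sYG _ q'GY] := and3P sylY; rewrite -p'natE //.
  by apply: pnat_dvd q'GY; rewrite indexgS // subsetI sYG (cNY q).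
have defG : 'C_G(N) * S = G.
  by apply: coprime_index_mulG; rewrite ?subsetIl // (pnat_coprime pGC).
have sNS : N \subset S.
  by apply: subset_trans (pcore_max pN nsNG) (pcore_sub_Hall sylS).
have [n defZ] := ucnP S (pgroup_nil pS).
apply: subset_trans (ucn_sub_hypercentre n G).
suff sub k x : x \in N -> x \in 'Z_k(S) -> x \in 'Z_k(G).
  by apply/subsetP=> x Nx; rewrite sub // defZ (subsetP sNS).
elim: k x => [|k IHk] x Nx; first by rewrite !ucn0.
case/mem_ucnS=> Sx Zx; apply/mem_ucnS; split=> [|g]; first exact: (subsetP sNG).
rewrite -{1}defG => /mulsgP[c s /setIP[_ cNc] Ss ->].
have -> : [~ x, c * s] = [~ x, s].
  rewrite commgMJ; suff -> : [~ x, c] = 1 by rewrite conj1g mulg1.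
  by apply/eqP/commgP/commute_sym/(centP cNc).
apply: IHk; last exact: Zx.
rewrite commgEl groupM ?groupV // memJ_norm //.
exact: (subsetP nNG _ (subsetP sSG s Ss)).
Qed.

(** The theorem of Maier and Schmid. *)
Lemma quasinormal_core_free_sub_hypercentre (gT : finGroupType)
    (A G : {group gT}) :
  quasinormal A G -> gcore A G = 1 -> A \subset hypercentre G.
Proof.
move=> qA coreA; have sAG := quasinormal_sub qA.
have nilA := quasinormal_core_free_nilpotent qA coreA.
rewrite -(Sylow_gen A) gen_subG; apply/bigcupsP=> P /SylowP[p p_pr sylP].
have hallM := nilpotent_pcore_Hall p nilA.
have [sPA pP _] := and3P sylP; have sPM : P \subset 'O_p(A).
  by rewrite (sub_Hall_pcore hallM).
apply: subset_trans sPM _; set M := 'O_p(A).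
have sMG : M \subset G := subset_trans (pcore_sub _ _) sAG.
have pM : p.-group M := pcore_pgroup _ _.
have coreM : gcore M G = 1.
  apply/trivgP; rewrite -coreA gcore_max ?gcore_norm //.
  exact: subset_trans (gcore_sub _ _) (pcore_sub _ _).
have cMY (q : nat) (Y : {group gT}) :
    q \in p^' -> q.-Sylow(G) Y -> Y \subset 'C(M).
  move=> p'q sylY; rewrite centsC; apply/commG1P/trivgP; rewrite -coreM.
  apply: commutator_Sylow_sub_gcore p'q sylY => // [x Gx p'x | g Gg p_g].
    exact: pi'_elt_norm_pcore qA Gx p'x.
  exact: commute_pcore qA hallM Gg p_g.
pose N := <<class_support M G>>%G.
apply: subset_trans (_ : N \subset _).
  by rewrite sub_gen ?sub_class_support.
have nsNG : N <| G.
  rewrite /normal gen_subG class_support_subG //.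
  exact: subset_trans (class_support_norm _ _) (norm_gen _).
apply: (@cent_Sylow_sub_hypercentre _ p) => // [|q Y p'q sylY].
  have snMG : M <|<| G.
    apply: subnormal_trans (normal_subnormal (pcore_normal _ _)) _.
    exact: quasinormal_subnormal.
  apply: pgroupS (pcore_pgroup p G).
  rewrite gen_subG class_support_sub_norm ?gFnorm //.
  exact: subnormal_pcore_sub.
rewrite centsC gen_subG; apply/subsetP=> _ /imset2P[m g Mm Gg ->].
rewrite -mem_conjgV -centJ.
have: Y :^ g^-1 \subset 'C(M) by apply: cMY p'q _; rewrite pHallJ ?groupV.
by rewrite centsC => /subsetP; apply.
Qed.

(** * Intersections *)

Lemma mem_ucn_quotientI (gT : finGroupType) (n : nat)
    (N N1 N2 G : {group gT}) x :
  N <| G -> N1 <| G -> N2 <| G -> N1 :&: N2 \subset N -> x \in G ->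
  coset N1 x \in 'Z_n(G / N1) -> coset N2 x \in 'Z_n(G / N2) ->
  coset N x \in 'Z_n(G / N).
Proof.
move=> /normal_norm nN /normal_norm nN1 /normal_norm nN2 sN.
elim: n x => [|n IHn] x Gx.
  rewrite !ucn0 => /set1P/coset_idr-N1x /set1P/coset_idr-N2x.
  rewrite coset_id ?set11 // (subsetP sN) // inE.
  by rewrite N1x ?N2x ?(subsetP nN1, subsetP nN2).
case/mem_ucnS=> _ Z1 /mem_ucnS[_ Z2]; apply/mem_ucnS.
split=> [|_ /morphimP[g nNg Gg ->]]; first exact: mem_quotient.
rewrite -morphR ?(subsetP nN) //; apply: IHn; first exact: groupR.
  by rewrite morphR ?(subsetP nN1) // Z1 ?mem_quotient.
by rewrite morphR ?(subsetP nN2) // Z2 ?mem_quotient.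
Qed.

Theorem corollary1p3 (gT : finGroupType) (G A B : {group gT})
    (qnA : quasinormal A G) (qnB : quasinormal B G) :
  normal_closure (A :&: B) G / gcore (A :&: B) G
    \subset hypercentre (G / gcore (A :&: B) G).
Proof.
have sAG := quasinormal_sub qnA; have sBG := quasinormal_sub qnB.
have sDG : A :&: B \subset G := subset_trans (subsetIl _ _) sAG.
have sZ (X : {group gT}) : quasinormal X G ->
    X / gcore X G \subset 'Z_#|G|(G / gcore X G).
  move=> qX; rewrite ucn_hypercentre ?leq_quotient //.
  apply: (@quasinormal_core_free_sub_hypercentre _ (X / gcore X G)%G) => /=.
    apply: quasinormal_quotient => //.
    exact: gcore_normal (quasinormal_sub qX).
  exact: gcore_quotient_trivg (quasinormal_sub qX).
pose N := gcore_group (A :&: B) G.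
have nsNG : N <| G := gcore_normal sDG.
rewrite -(@ucn_hypercentre _ (G / N) #|G|) ?leq_quotient //.
have nNG := normal_norm nsNG.
rewrite sub_quotient_pre; last first.
  by rewrite (subset_trans _ nNG) // gen_subG class_support_subG.
rewrite gen_subG; apply/subsetP=> _ /imset2P[x g /setIP[Ax Bx] Gg ->].
have Gx := subsetP sAG x Ax.
rewrite inE groupJ ?(subsetP nNG) //= inE morphJ ?(subsetP nNG) //.
rewrite memJ_norm ?(subsetP (ucn_norm _ _)) ?mem_quotient //.
apply: (@mem_ucn_quotientI _ _ _ (gcore_group A G) (gcore_group B G)) => //.
- exact: gcore_normal.
- exact: gcore_normal.
- rewrite gcore_max ?normsI ?gcore_norm //.
  by rewrite setISS ?gcore_sub.
- by rewrite (subsetP (sZ A qnA)) ?mem_quotient.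
by rewrite (subsetP (sZ B qnB)) ?mem_quotient.
Qed.
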